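(* In the Fireball Calculus: (1) every closed $\to_{\mathtt f}$-normal term is a fireball; (2) $\to_{\mathtt f}$ is deterministic.
   Context: Terms of the Fireball Calculus: $t,u ::= x\mid a\mid\lambda x.t\mid tu$, where $x$ ranges over variables and $a$ over a separate set of symbols (constants, never bound nor substituted). Terms are taken up to $\alpha$-equivalence; $t\{x\leftarrow u\}$ is capture-avoiding substitution; a term is closed if it has no free variables (symbols are allowed). Values $v::=\lambda x.t$; fireballs $f::=v\mid A$; inerts $A::=a\mid Af$. Evaluation contexts $F::=\langle\cdot\rangle\mid tF\mid Ff$. The reduction is $F\langle(\lambda x.t)f\rangle\to_{\mathtt f}F\langle t\{x\leftarrow f\}\rangle$, for $F$ an evaluation context and $f$ a fireball. Deterministic means that every term has at most one $\to_{\mathtt f}$-redex (hence at most one reduct). *)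

(* Defs.v *)
From Stdlib Require Import PeanoNat.

Set Implicit Arguments.

(* Terms up to alpha-equivalence are represented with de Bruijn indices:
   [Var n] refers to the n-th enclosing [Lam], counting from 0, or is a free
   variable when there are at most n enclosing [Lam]s.  Symbols, drawn from an
   arbitrary type [Symb], are never bound and hence plain leaves. *)
Inductive term (Symb : Type) : Type :=
| Var (n : nat)
| Sym (a : Symb)
| Lam (t : term Symb)
| App (t u : term Symb).

Arguments Var {Symb} n.

(* [free k t]: the variable with index [k], seen from the root of [t], occurs
   free in [t]. *)
Fixpoint free (Symb : Type) (k : nat) (t : term Symb) : Prop :=
  match t with
  | Var n => n = k
  | Sym _ => False
  | Lam t => free (1 + k) t
  | App t u => free k t \/ free k u
  end.

Definition closed (Symb : Type) (t : term Symb) : Prop := forall k, ~ free k t.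

(* [lift k t] increments the indices of [t] that are at least [k]. *)
Fixpoint lift (Symb : Type) (k : nat) (t : term Symb) : term Symb :=
  match t with
  | Var n => if n <? k then Var n else Var (1 + n)
  | Sym a => Sym a
  | Lam t => Lam (lift (1 + k) t)
  | App t u => App (lift k t) (lift k u)
  end.

(* [subst k u t] replaces index [k] by [u] in [t] and decrements the indices
   above [k], since the binder of [k] disappears. *)
Fixpoint subst (Symb : Type) (k : nat) (u t : term Symb) : term Symb :=
  match t with
  | Var n => match n ?= k with
             | Lt => Var n
             | Eq => u
             | Gt => Var (n - 1)
             end
  | Sym a => Sym a
  | Lam t => Lam (subst (1 + k) (lift 0 u) t)
  | App t1 t2 => App (subst k u t1) (subst k u t2)
  end.

Inductive value (Symb : Type) : term Symb -> Prop :=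
| value_lam t : value (Lam t).

Inductive fireball (Symb : Type) : term Symb -> Prop :=
| fireball_value v : value v -> fireball v
| fireball_inert A : inert A -> fireball A
with inert (Symb : Type) : term Symb -> Prop :=
| inert_sym a : inert (Sym a)
| inert_app A f : inert A -> fireball f -> inert (App A f).

(* One-hole contexts whose hole is not under a binder, so that plugging never
   captures variables; [eval_ctx] carves out the evaluation contexts. *)
Inductive ctx (Symb : Type) : Type :=
| Hole
| CAppR (t : term Symb) (F : ctx Symb)
| CAppL (F : ctx Symb) (u : term Symb).

Fixpoint plug (Symb : Type) (F : ctx Symb) (t : term Symb) : term Symb :=
  match F with
  | Hole _ => t
  | CAppR u F => App u (plug F t)
  | CAppL F u => App (plug F t) u
  end.

Inductive eval_ctx (Symb : Type) : ctx Symb -> Prop :=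
| eval_hole : eval_ctx (Hole Symb)
| eval_appR t F : eval_ctx F -> eval_ctx (CAppR t F)
| eval_appL F f : eval_ctx F -> fireball f -> eval_ctx (CAppL F f).

Inductive root_step (Symb : Type) : term Symb -> term Symb -> Prop :=
| root_beta t f : fireball f -> root_step (App (Lam t) f) (subst 0 f t).

Inductive step (Symb : Type) : term Symb -> term Symb -> Prop :=
| step_ctx F r r' :
    eval_ctx F -> root_step r r' -> step (plug F r) (plug F r').

Definition normal (Symb : Type) (t : term Symb) : Prop := forall u, ~ step t u.

(* A redex of [t] is an occurrence: a subterm [r] that can be fired, together
   with the evaluation context [F] that locates it in [t]. *)
Definition redex_of (Symb : Type) (t : term Symb) (F : ctx Symb) (r : term Symb) : Prop :=
  eval_ctx F /\ (exists r', root_step r r') /\ t = plug F r.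

Definition at_most_one_redex (Symb : Type) (t : term Symb) : Prop :=
  forall F1 r1 F2 r2,
    redex_of t F1 r1 -> redex_of t F2 r2 -> F1 = F2 /\ r1 = r2.

Definition at_most_one_reduct (Symb : Type) (t : term Symb) : Prop :=
  forall u1 u2, step t u1 -> step t u2 -> u1 = u2.

Definition deterministic (Symb : Type) : Prop :=
  forall t : term Symb, at_most_one_redex t /\ at_most_one_reduct t.

(* Main.v *)
(* A fireball contains no redex in evaluation position.  Since the context
   [CAppL F f] may enter the left of an application only when its right side is
   already a fireball, at most one of "left", "right" and "root" can host a
   redex of a given application. *)
Require Import Defs.

Set Implicit Arguments.

Lemma step_appR (Symb : Type) (t u u' : term Symb) :
  step u u' -> step (App t u) (App t u').
Proof.
  intros H; destruct H as [F r r' HF Hr].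
  exact (step_ctx (eval_appR t HF) Hr).
Qed.

Lemma step_appL (Symb : Type) (t t' f : term Symb) :
  fireball f -> step t t' -> step (App t f) (App t' f).
Proof.
  intros Hf H; destruct H as [F r r' HF Hr].
  exact (step_ctx (eval_appL HF Hf) Hr).
Qed.

(** Closedness only serves to exclude variables. In an application the right side comes first: the
    left side is an evaluation position only once the right side is known to be a fireball. *)
Lemma closed_normal_fireball (Symb : Type) (t : term Symb) :
  closed t -> normal t -> fireball t.
Proof.
  induction t as [n | a | t _ | t IHt u IHu]; intros Hc Hn.
  - destruct (Hc n eq_refl).
  - apply fireball_inert, inert_sym.
  - apply fireball_value, value_lam.
  - assert (Hu : fireball u).
    { apply IHu.
      - intros k Hk; apply (Hc k); right; exact Hk.
      - intros u' Hs; exact (Hn _ (step_appR t Hs)). }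
    assert (Ht : fireball t).
    { apply IHt.
      - intros k Hk; apply (Hc k); left; exact Hk.
      - intros t' Hs; exact (Hn _ (step_appL Hu Hs)). }
    (* An abstraction on the left would make the whole application a redex, so the left side is
       inert. *)
    destruct Ht as [v [s] | A HA].
    + destruct (Hn _ (step_ctx (eval_hole Symb) (root_beta s Hu))).
    + apply fireball_inert, inert_app; assumption.
Qed.

Lemma fireball_app_inv (Symb : Type) (t u : term Symb) :
  fireball (App t u) -> inert t /\ fireball u.
Proof.
  intros H; inversion H as [v Hv | A HA]; subst.
  - inversion Hv.
  - inversion HA; subst; split; assumption.
Qed.

(** A root redex has an abstraction where a fireball application needs an inert. Deeper redexes
    reduce to this case, since both sides of a fireball application are fireballs. *)
Lemma fireball_redex_free (Symb : Type) (F : ctx Symb) (r r' : term Symb) :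
  eval_ctx F -> root_step r r' -> ~ fireball (plug F r).
Proof.
  intros HF Hr; induction HF as [| t F _ IH | F f _ IH _]; simpl; intros H.
  - destruct Hr as [t f Hf].
    apply fireball_app_inv in H as [H _]; inversion H.
  - apply fireball_app_inv in H as [_ H]; exact (IH H).
  - apply fireball_app_inv in H as [H _]; exact (IH (fireball_inert H)).
Qed.

Lemma lam_redex_free (Symb : Type) (F : ctx Symb) (r r' t : term Symb) :
  eval_ctx F -> root_step r r' -> Lam t <> plug F r.
Proof.
  intros HF Hr E; apply (fireball_redex_free HF Hr); rewrite <- E.
  apply fireball_value, value_lam.
Qed.

(** The two sides of the root redex [s] are an abstraction and a fireball, neither of which can host
    [r]. *)
Lemma root_redex_hole (Symb : Type) (F : ctx Symb) (r r' s s' : term Symb) :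
  eval_ctx F -> root_step r r' -> root_step s s' -> s = plug F r ->
  F = Hole Symb.
Proof.
  intros HF Hr Hs E; destruct Hs as [t f Hf].
  destruct HF as [| u F HF | F u HF _]; simpl in E.
  - reflexivity.
  - injection E as _ E; subst f; destruct (fireball_redex_free HF Hr Hf).
  - injection E as E _; destruct (lam_redex_free HF Hr E).
Qed.

Lemma redex_unique (Symb : Type) (t : term Symb) : at_most_one_redex t.
Proof.
  intros F1 r1 F2 r2 [HF1 [[r1' H1] E1]] [HF2 [[r2' H2] E2]].
  rewrite E1 in E2; clear t E1.
  revert F2 HF2 E2.
  induction HF1 as [| u F1 HF1 IH | F1 f HF1 IH Hf]; intros F2 HF2 E.
  - pose proof (root_redex_hole HF2 H2 H1 E); subst F2.
    split; [reflexivity | exact E].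
  - destruct HF2 as [| u2 F2 HF2 | F2 f2 HF2 Hf2]; simpl in E.
    + discriminate (root_redex_hole (eval_appR u HF1) H1 H2 (eq_sym E)).
    + injection E as -> E; destruct (IH F2 HF2 E) as [-> ->]; split; reflexivity.
    (* [F2] enters the left side, so the right side is a fireball, yet [F1] locates a redex
       there. *)
    + injection E as _ E; subst f2; destruct (fireball_redex_free HF1 H1 Hf2).
  - destruct HF2 as [| u2 F2 HF2 | F2 f2 HF2 Hf2]; simpl in E.
    + discriminate (root_redex_hole (eval_appL HF1 Hf) H1 H2 (eq_sym E)).
    (* The mirror conflict: [F1] requires a fireball on the right, where [F2] locates a redex. *)
    + injection E as _ E; subst f; destruct (fireball_redex_free HF2 H2 Hf).
    + injection E as E ->; destruct (IH F2 HF2 E) as [-> ->]; split; reflexivity.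
Qed.

Lemma root_step_functional (Symb : Type) (r s1 s2 : term Symb) :
  root_step r s1 -> root_step r s2 -> s1 = s2.
Proof.
  intros H1 H2; destruct H1; inversion H2; reflexivity.
Qed.

Lemma reduct_unique (Symb : Type) (t : term Symb) : at_most_one_reduct t.
Proof.
  intros u1 u2 S1 S2.
  destruct S1 as [F1 r1 s1 HF1 H1].
  (* Naming the source keeps the equation between the two decompositions when [S2] is destructed. *)
  remember (plug F1 r1) as t eqn:E.
  destruct S2 as [F2 r2 s2 HF2 H2].
  destruct (@redex_unique _ (plug F2 r2) F1 r1 F2 r2) as [-> ->].
  - split; [exact HF1 | split; [exists s1; exact H1 | exact E]].
  - split; [exact HF2 | split; [exists s2; exact H2 | reflexivity]].
  - rewrite (root_step_functional H1 H2); reflexivity.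
Qed.

Theorem theorem1 (Symb : Type) :
  (forall t : term Symb, closed t -> normal t -> fireball t) /\
  deterministic Symb.
Proof.
  split.
  - exact (@closed_normal_fireball Symb).
  - intros t; split; [apply redex_unique | apply reduct_unique].
Qed.
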